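(* Let $D$ be a finite digraph and $\alpha=(\alpha_u)_{u\in V(D)}$ a family of mutually disjoint finite digraphs. Suppose $D$ has a semi-Grundy function $f$ and each $\alpha_u$ has a semi-Grundy function $s_u$ ($u\in V(D)$) such that $\max\{s_u(x): x\in V(\alpha_u)\}=\max\{s_v(x): x\in V(\alpha_v)\}$ whenever $\{u,v\}\subseteq f^{-1}(i)$ for some $i\in\mathbb{N}$. Let $n=\max\{f(x): x\in V(D)\}$ and, for $0\le i\le n$, $m_i=\max\{s_v(x): x\in V(\alpha_v),\ v\in f^{-1}(i)\}$. Then $\sigma(D,\alpha)$ has a semi-Grundy function $S$ with $\max\{S(x): x\in V(\sigma(D,\alpha))\}=n+\sum_{i=0}^n m_i$.
   Context: All digraphs are finite. For a vertex $x$ of a digraph $D$, $\Gamma^+(x)$ denotes the set of out-neighbours of $x$. A function $s:V(D)\to\mathbb{N}$ (with $\mathbb{N}=\{0,1,2,\dots\}$) is a semi-Grundy function of $D$ if (1) whenever $s(x)=k$, every $y\in\Gamma^+(x)$ satisfies $s(y)\neq k$; and (2) whenever $s(x)=k$, $y\in\Gamma^+(x)$ and $s(y)>k$, there exists $z\in\Gamma^+(y)$ with $s(z)=k$. Standing convention of the paper: every semi-Grundy function takes as its set of values a set of consecutive non-negative integers starting at $0$. Given $D$ and a family $\alpha=(\alpha_v)_{v\in V(D)}$ of mutually disjoint digraphs, the Cartesian product $\sigma(D,\alpha)$ has vertex set $\bigcup_{v}V(\alpha_v)$ and arc set $\bigcup_{v}A(\alpha_v)\cup\{(x,y): x\in V(\alpha_u),\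 y\in V(\alpha_v),\ (u,v)\in A(D)\}$. *)

(* Defs.v *)
From mathcomp Require Import all_boot.

Set Implicit Arguments.
Unset Strict Implicit.
Unset Printing Implicit Defensive.

Record digraph : Type := Digraph { vertex :> finType; darc : rel vertex }.

Section SemiGrundy.

Variables (D : digraph) (s : D -> nat).

Definition max_value : nat := \max_(x : D) s x.

(* The third clause is the convention that the set of values is {0, ..., m}
   for some m; in particular D has at least one vertex. *)
Definition semi_grundy : Prop :=
  [/\ forall x y : D, darc x y -> s y <> s x,
      forall x y : D, darc x y -> s x < s y ->
        exists2 z : D, darc y z & s z = s x
    & exists m : nat, forall k : nat, (exists x : D, s x = k) <-> k <= m].

End SemiGrundy.

Section CartesianProduct.

Variables (D : digraph) (alpha : D -> digraph).

(* Mutual disjointness of the alpha v is obtained by tagging: a vertex of the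
   product is a pair (v, x) with x a vertex of alpha v.  When the tags of p and
   q agree, tagged_as p q is the second component of q seen in alpha (tag p). *)
Definition sigma_arc : rel {v : D & alpha v} :=
  fun p q =>
    ((tag p == tag q) && darc (tagged p) (tagged_as p q))
    || darc (tag p) (tag q).

Definition sigma_product : digraph := Digraph sigma_arc.

End CartesianProduct.

(* Main.v *)
(** Let [o i] be the sum of the [m j + 1] over [j < i]. The function
    [S (v, x) = o (f v) + s v x] works: the vertices over [f^-1(i)] take
    exactly the values of the block [o i, ..., o i + m i], and these blocks
    are consecutive. *)
Require Import Defs.
From mathcomp Require Import all_boot zify.

Definition block_start (m : nat -> nat) (i : nat) : nat :=
  \sum_(0 <= j < i) (m j).+1.

Lemma block_startS (m : nat -> nat) (i : nat) :
  block_start m i.+1 = block_start m i + (m i).+1.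
Proof. by rewrite /block_start big_nat_recr. Qed.

(** At [i = n.+1] the right side is one more than the maximum claimed for [S], so the admissible
    values are those strictly below [block_start m n.+1]. *)
Lemma block_start_sum (m : nat -> nat) (i : nat) :
  block_start m i = i + \sum_(0 <= j < i) m j.
Proof.
elim: i => [|i IHi]; first by rewrite /block_start !big_geq.
by rewrite block_startS IHi big_nat_recr //=; lia.
Qed.

Lemma leq_block_start (m : nat -> nat) (i j : nat) :
  i <= j -> block_start m i <= block_start m j.
Proof.
move=> /subnKC <-; elim: (j - i) => [|k IHk]; first by rewrite addn0.
by rewrite addnS block_startS (leq_trans IHk) ?leq_addr.
Qed.

(** Block [i] ends at [block_start m i + m i], just before [block_start m i.+1], and the starts are
    monotone. *)
Lemma block_ltn (m : nat -> nat) (i j a b : nat) :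
  i < j -> a <= m i -> block_start m i + a < block_start m j + b.
Proof. by move=> /(@leq_block_start m); rewrite block_startS; lia. Qed.

(** Induction on the number of blocks: [k] lies before the last block or has offset
    [k - block_start m n] in it. *)
Lemma block_decomposition (m : nat -> nat) (n k : nat) :
  k < block_start m n ->
  exists i a, [/\ i < n, a <= m i & k = block_start m i + a].
Proof.
elim: n => [|n IHn]; first by rewrite /block_start big_geq.
have [/IHn[i [a [lt_in le_a ->]]] _ | le_k] := ltnP k (block_start m n).
  by exists i, a; rewrite ltnS ltnW.
by rewrite block_startS => lt_k; exists n, (k - block_start m n); split; lia.
Qed.

Lemma max_value_eq (D : digraph) (s : D -> nat) (M : nat) :
  (forall k, (exists x, s x = k) <-> k <= M) -> max_value s = M.
Proof.
move=> valM; apply/eqP; rewrite eqn_leq; apply/andP; split.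
  by apply/bigmax_leqP => x _; apply/valM; exists x.
by have [x <-] := (valM M).2 (leqnn M); apply: leq_bigmax.
Qed.

Lemma semi_grundy_values (D : digraph) (s : D -> nat) :
  semi_grundy s -> forall k, (exists x, s x = k) <-> k <= max_value s.
Proof. by case=> _ _ [M valM]; rewrite (max_value_eq _ _ _ valM). Qed.

Theorem theorem7 (D : digraph) (alpha : D -> digraph)
    (f : D -> nat) (s : forall u : D, alpha u -> nat)
    (f_sg : semi_grundy f)
    (s_sg : forall u : D, semi_grundy (s u))
    (s_max : forall (i : nat) (u v : D), f u = i -> f v = i ->
       max_value (s u) = max_value (s v)) :
  let n := max_value f in
  let m (i : nat) := \max_(v : D | f v == i) \max_(x : alpha v) s v x in
  exists2 S : sigma_product alpha -> nat,
    semi_grundy S & max_value S = n + \sum_(0 <= i < n.+1) m i.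
Proof.
move=> n m.
(* By [s_max], the outer maximum ranges over equal terms, one of which comes from [v] itself. *)
have mE v : m (f v) = max_value (s v).
  apply/eqP; rewrite eqn_leq; apply/andP; split.
    by apply/bigmax_leqP => u /eqP fu; rewrite -(s_max (f v) u v fu erefl).
  exact: (leq_bigmax_cond (F := fun v => \max_x s v x)).
have s_le v x : s v x <= m (f v) by rewrite mE; apply: leq_bigmax.
pose S (p : sigma_product alpha) : nat :=
  block_start m (f (tag p)) + s (tag p) (tagged p).
have valS k : (exists p, S p = k) <-> k <= n + \sum_(0 <= i < n.+1) m i.
  rewrite -ltnS -addSn -block_start_sum; split.
    (* The offset [0] turns the bound into a comparison with block [n.+1], the first one past every
       value of [f]. *)
    case=> p <-; rewrite -(addn0 (block_start m n.+1)).
    by apply: block_ltn; rewrite // ltnS; apply: leq_bigmax.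
  case/block_decomposition=> i [a [lt_in le_a ->]].
  have [v fv] := (semi_grundy_values _ _ f_sg i).2 lt_in.
  (* Any [v] at level [i] will do: by [mE], [s v] attains every value up to [m i]. *)
  have [x sx] : exists x, s v x = a.
    by apply/(semi_grundy_values _ _ (s_sg v)); rewrite -mE fv.
  by exists (existT _ v x); rewrite /S /= fv sx.
exists S; last exact: max_value_eq.
case: (f_sg) => f_neq f_abs _; split;
  last by exists (n + \sum_(0 <= i < n.+1) m i).
- move=> [u x] [v y] /= /orP[/andP[/= /eqP uv]|/= /f_neq fuv].
    case: v / uv y => y; rewrite tagged_asE /S /= => xy /addnI.
    by case: (s_sg u) => s_neq _ _; apply: s_neq.
  rewrite /S /=; have [lt_uv|lt_vu|eq_uv] := ltngtP (f u) (f v).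
    by have := block_ltn m _ _ _ (s v y) lt_uv (s_le u x); lia.
  by have := block_ltn m _ _ _ (s u x) lt_vu (s_le v y); lia.
  by case: fuv.
- move=> [u x] [v y] /= /orP[/andP[/= /eqP uv]|/= uv].
    case: v / uv y => y; rewrite tagged_asE /S /= ltn_add2l => xy lt_xy.
    have [_ s_abs _] := s_sg u; have [z yz sz] := s_abs _ _ xy lt_xy.
    exists (existT _ u z); last by rewrite /= sz.
    by rewrite /= /sigma_arc /= eqxx tagged_asE yz.
  rewrite {1 2}/S /= => lt_S.
  (* Adjacent [u] and [v] lie on different levels, and [f v < f u] would reverse the order of the
     blocks, against [lt_S]. *)
  have lt_uv : f u < f v.
    rewrite ltn_neqAle eq_sym; apply/andP; split; first exact/eqP/f_neq.
    rewrite leqNgt; apply/negP => lt_vu.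
    by have := block_ltn m _ _ _ (s u x) lt_vu (s_le v y); lia.
  have [w vw fw] := f_abs _ _ uv lt_uv.
  (* Since [f w = f u], the maxima of [s w] and [s u] agree, so the offset [s u x] also occurs in
     [alpha w]; the arc from [v] to [w] then reaches such a [z] from [y]. *)
  have [z sz] : exists z, s w z = s u x.
    by apply/(semi_grundy_values _ _ (s_sg w)); rewrite -mE fw.
  exists (existT _ w z); first by rewrite /= /sigma_arc /= vw orbT.
  by rewrite /S /= fw sz.
Qed.
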